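(* Consider the plant $x[t+1]=Ax[t]+Bu[t]+\delta_x[t]$, $y[t]=Cx[t]+\delta_y[t]$ with $(A,B)$ stabilizable and $(A,C)$ detectable, $\mathbf{G}=C(zI-A)^{-1}B$, evolving under a dynamic control policy $\mathbf{u}=\mathbf{K}\mathbf{y}+\delta_u$. Consider the following constraints on transfer matrices $\boldsymbol{\Phi}_{xy},\boldsymbol{\Phi}_{uy},\boldsymbol{\Phi}_{xu},\boldsymbol{\Phi}_{uu}$: $$\begin{bmatrix} zI-A & -B\end{bmatrix}\begin{bmatrix}\boldsymbol{\Phi}_{xy}&\boldsymbol{\Phi}_{xu}\\ \boldsymbol{\Phi}_{uy}&\boldsymbol{\Phi}_{uu}\end{bmatrix}=0,\qquad \begin{bmatrix}\boldsymbol{\Phi}_{xy}&\boldsymbol{\Phi}_{xu}\\ \boldsymbol{\Phi}_{uy}&\boldsymbol{\Phi}_{uu}\end{bmatrix}\begin{bmatrix}-\mathbf{G}\\ I\end{bmatrix}=\begin{bmatrix}(zI-A)^{-1}B\\ I\end{bmatrix},\qquad \boldsymbol{\Phi}_{xy},\boldsymbol{\Phi}_{uy},\boldsymbol{\Phi}_{xu},\boldsymbol{\Phi}_{uu}\in\mathcal{RH}_\infty.\quad( * )$$ Then: (1) For any $\mathbf{K}\in\mathcal{C}_{\mathrm{stab}}$, the resulting closed-loop responses $\boldsymbol{\Phi}_{xy},\boldsymbol{\Phi}_{xu},\boldsymbol{\Phi}_{uy},\boldsymbol{\Phi}_{uu}$ from $(\delta_y,\delta_u)$ to $(\mathbf{x},\mathbf{u})$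 satisfy $( * )$. (2) For any transfer matrices $\boldsymbol{\Phi}_{xy},\boldsymbol{\Phi}_{uy},\boldsymbol{\Phi}_{xu},\boldsymbol{\Phi}_{uu}$ satisfying $( * )$, $\mathbf{K}=\boldsymbol{\Phi}_{uu}^{-1}\boldsymbol{\Phi}_{uy}\in\mathcal{C}_{\mathrm{stab}}$.
   Context: All systems are discrete-time, linear time-invariant with real matrices; $x[t]\in\mathbb{R}^n$, $u[t]\in\mathbb{R}^m$, $y[t]\in\mathbb{R}^p$; $\delta_x,\delta_y,\delta_u$ are external disturbances. A controller is $\xi[t+1]=A_k\xi[t]+B_ky[t]$, $u[t]=C_k\xi[t]+D_ky[t]+\delta_u[t]$, with $\mathbf{K}=C_k(zI-A_k)^{-1}B_k+D_k$; its realization is always taken with $(A_k,B_k)$ stabilizable and $(A_k,C_k)$ detectable. $\mathbf{K}$ internally stabilizes $\mathbf{G}$ if $(x[t],\xi[t])\to0$ as $t\to\infty$ for all initial states when all disturbances are zero. $\mathcal{C}_{\mathrm{stab}}$ is the set of all (proper real-rational) $\mathbf{K}$ that internally stabilize $\mathbf{G}$. $\mathcal{RH}_\infty$ is the set of real-rational proper stable transfer matrices (all poles of modulus $<1$). The closed-loop responses ($\boldsymbol{\Phi}_{ab}$ is from $\delta_b$ to $\mathbf{a}$) are $\boldsymbol{\Phi}_{xy}=\boldsymbol{\Phi}_{xx}B\mathbf{K}$, $\boldsymbol{\Phi}_{xu}=\boldsymbol{\Phi}_{xx}B$, $\boldsymbol{\Phi}_{uy}=\mathbf{K}(C\boldsymbol{\Phi}_{xx}B\mathbf{K}+I)$,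 $\boldsymbol{\Phi}_{uu}=\mathbf{K}C\boldsymbol{\Phi}_{xx}B+I$, where $\boldsymbol{\Phi}_{xx}=(zI-A-B\mathbf{K}C)^{-1}$. *)

(* Defs.v *)
From HB Require Import structures.
From mathcomp Require Import all_boot all_order all_algebra.
From mathcomp Require Import complex.
From mathcomp Require Import boolp classical_sets reals topology normedtype
  sequences.

Set Implicit Arguments.
Unset Strict Implicit.
Unset Printing Implicit Defensive.

Import Order.TTheory GRing.Theory Num.Theory.
Import numFieldNormedType.Exports.

Local Open Scope classical_set_scope.
Local Open Scope ring_scope.
Local Open Scope complex_scope.

(* Real-rational functions, i.e. the field R(z). *)
Notation ratfun R := {fraction {poly R}}.

Section RationalFunctions.
Variable R : realType.

Definition zvar : ratfun R := tofrac 'X.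

Definition constmx (m n : nat) (M : 'M[R]_(m, n)) : 'M[ratfun R]_(m, n) :=
  map_mx (@tofrac {poly R} \o polyC) M.

(* The denominator must be nonzero, since x / 0 = 0 in a fieldType. *)
Definition proper_ratfun (q : ratfun R) : Prop :=
  exists a b : {poly R},
    [/\ b != 0, q = tofrac a / tofrac b & (size a <= size b)%N].

Definition pole (q : ratfun R) (z : R[i]) : Prop :=
  exists a b : {poly R},
    [/\ b != 0, coprimep a b, q = tofrac a / tofrac b &
        root (map_poly (real_complex R) b) z].

Definition RHinf (m n : nat) : set 'M[ratfun R]_(m, n) :=
  [set M : 'M[ratfun R]_(m, n) | forall i j,
     proper_ratfun (M i j) /\ (forall z : R[i], pole (M i j) z -> `|z| < 1)].

End RationalFunctions.

Section StateSpace.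
Variable R : realType.

Definition schur_stable (n : nat) (A : 'M[R]_n) : Prop :=
  forall z : R[i], eigenvalue (map_mx (real_complex R) A) z -> `|z| < 1.

Definition stabilizable (n m : nat) (A : 'M[R]_n) (B : 'M[R]_(n, m)) : Prop :=
  exists F : 'M[R]_(m, n), schur_stable (A + B *m F).

Definition detectable (n p : nat) (A : 'M[R]_n) (C : 'M[R]_(p, n)) : Prop :=
  exists L : 'M[R]_(n, p), schur_stable (A + L *m C).

(* (zI - A)^-1; zI - A is always a unit, its determinant being the
   characteristic polynomial of A. *)
Definition resolvent (n : nat) (A : 'M[R]_n) : 'M[ratfun R]_n :=
  invmx ((zvar R)%:M - constmx A).

Definition plant_tf (n m p : nat) (A : 'M[R]_n) (B : 'M[R]_(n, m))
    (C : 'M[R]_(p, n)) : 'M[ratfun R]_(p, m) :=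
  constmx C *m resolvent A *m constmx B.

Record controller (p m : nat) := Controller {
  kdim : nat;
  Ak : 'M[R]_kdim;
  Bk : 'M[R]_(kdim, p);
  Ck : 'M[R]_(m, kdim);
  Dk : 'M[R]_(m, p) }.

Definition controller_tf (p m : nat) (c : controller p m) :
    'M[ratfun R]_(m, p) :=
  constmx (Ck c) *m resolvent (Ak c) *m constmx (Bk c) + constmx (Dk c).

Section ClosedLoop.
Variables (n m p : nat).
Variables (A : 'M[R]_n) (B : 'M[R]_(n, m)) (C : 'M[R]_(p, n)).

Definition closed_loop (c : controller p m)
    (dx : nat -> 'cV[R]_n) (dy : nat -> 'cV[R]_p) (du : nat -> 'cV[R]_m)
    (x : nat -> 'cV[R]_n) (xi : nat -> 'cV[R]_(kdim c))
    (y : nat -> 'cV[R]_p) (u : nat -> 'cV[R]_m) : Prop :=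
  forall t : nat,
    [/\ x t.+1 = A *m x t + B *m u t + dx t,
        y t = C *m x t + dy t,
        xi t.+1 = Ak c *m xi t + Bk c *m y t &
        u t = Ck c *m xi t + Dk c *m y t + du t].

Definition internally_stabilizing (c : controller p m) : Prop :=
  forall x xi y u,
    @closed_loop c (fun=> 0) (fun=> 0) (fun=> 0) x xi y u ->
    (x @ \oo --> (0 : 'cV[R]_n)) /\ (xi @ \oo --> (0 : 'cV[R]_(kdim c))).

(* K is automatically proper, being the transfer matrix of a controller; all
   stabilizable and detectable realizations of the same K are internally
   stabilizing as soon as one of them is. *)
Definition Cstab : set 'M[ratfun R]_(m, p) :=
  [set K | exists c : controller p m,
     [/\ controller_tf c = K, stabilizable (Ak c) (Bk c),
         detectable (Ak c) (Ck c) & internally_stabilizing c]].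

Section Responses.
Variable K : 'M[ratfun R]_(m, p).

(* For proper K the inverted matrix is a unit: its determinant is z ^+ n times
   a rational function equal to 1 at infinity. *)
Definition Phi_xx : 'M[ratfun R]_n :=
  invmx ((zvar R)%:M - constmx A - constmx B *m K *m constmx C).

Definition Phi_xy : 'M[ratfun R]_(n, p) := Phi_xx *m constmx B *m K.

Definition Phi_xu : 'M[ratfun R]_(n, m) := Phi_xx *m constmx B.

Definition Phi_uy : 'M[ratfun R]_(m, p) :=
  K *m (constmx C *m Phi_xx *m constmx B *m K + 1%:M).

Definition Phi_uu : 'M[ratfun R]_m :=
  K *m constmx C *m Phi_xx *m constmx B + 1%:M.

End Responses.

Definition response_constraints
    (Pxy : 'M[ratfun R]_(n, p)) (Pxu : 'M[ratfun R]_(n, m))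
    (Puy : 'M[ratfun R]_(m, p)) (Puu : 'M[ratfun R]_m) : Prop :=
  [/\ row_mx ((zvar R)%:M - constmx A) (- constmx B)
        *m block_mx Pxy Pxu Puy Puu = 0,
      block_mx Pxy Pxu Puy Puu *m col_mx (- plant_tf A B C) 1%:M
        = col_mx (resolvent A *m constmx B) 1%:M &
      [/\ RHinf Pxy, RHinf Puy, RHinf Pxu & RHinf Puu]].

End ClosedLoop.
End StateSpace.

(* Main.v *)
Require Import Defs.
From HB Require Import structures.
From mathcomp Require Import all_boot all_order all_algebra.
From mathcomp Require Import complex.
From mathcomp Require Import boolp classical_sets reals topology normedtype
  sequences.
From mathcomp Require Import perm ring lra zify.

(* (1) The closed loop is an autonomous system with matrix Acl, and internal
   stability forces Acl to be Schur stable.  The blocks of (zI - Acl)^-1 express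
   all four responses, which are therefore stable and proper; the affine
   constraints are resolvent identities.

   (2) Puu^-1 Puy is in general not a coprime factorization of K (both factors
   are divisible on the left by M below), so K cannot be realized from a
   realization of [Puy Puu].  Instead pick F and L with A + BF and A + LC
   Schur stable and put Ut = Puu - F Pxu, Vt = Puy - F Pxy,
   M = I + F (zI - A - BF)^-1 B, N = C (zI - A - BF)^-1 B.  The constraints give
   Puu = M Ut, Puy = M Vt and the Bezout identity Ut M - Vt N = I.  From it one
   reads off a Youla parameter
     Q = Vt (I - C (zI - A - BF)^-1 L) + Ut F (zI - A - BF)^-1 L,
   stable and proper, such that K = Ut^-1 Vt is the transfer matrix of the
   observer-based controller with parameter Q.  That controller is visibly
   stabilizable, detectable and internally stabilizing, the closed loop being
   block triangular in the coordinates (x, x - xh, q). *)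

Set Implicit Arguments.
Unset Strict Implicit.
Unset Printing Implicit Defensive.

Import Order.TTheory GRing.Theory Num.Theory.
Import numFieldNormedType.Exports.

Local Open Scope classical_set_scope.
Local Open Scope ring_scope.

(** * Schur stability and convergence *)

Section Vanishing.
Variable R : realType.
Local Open Scope complex_scope.
Local Notation normc := ComplexField.Normc.normc.

Lemma cvg0_contraction (r : R) (a b : nat -> R) :
    0 <= r < 1 -> (forall t, 0 <= a t) ->
    (forall t, a t.+1 <= r * a t + b t) ->
  b @ \oo --> 0 -> a @ \oo --> 0.
Proof.
move=> /andP[r0 r1] a0 aS b0; apply/cvgr0Pnorm_lt => e e0.
(* This threshold makes [e / 2] a fixed point of the perturbed bound:
   [r * (e / 2) + (1 - r) * (e / 2) = e / 2], so the induction on [k] closes. *)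
have d0 : 0 < (1 - r) * (e / 2) by rewrite mulr_gt0 ?subr_gt0 ?divr_gt0.
have /cvgr0Pnorm_lt/(_ _ d0)[N _ bN] := b0.
have aN k : a (N + k)%N <= r ^+ k * a N + e / 2.
  elim: k => [|k IH].
    by rewrite addn0 expr0 mul1r lerDl divr_ge0// ltW.
  rewrite addnS (le_trans (aS _))//.
  have /ltW : `|b (N + k)%N| < (1 - r) * (e / 2) by apply: bN => /=; lia.
  move=> /(le_trans (ler_norm _)) bb.
  rewrite exprS -mulrA.
  have := ler_wpM2l r0 IH; lra.
have : (geometric (a N) r) @ \oo --> 0.
  by apply: cvg_geometric; rewrite ger0_norm.
have e20 : 0 < e / 2 by rewrite divr_gt0.
move=> /cvgr0Pnorm_lt/(_ _ e20)[M _ gM].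
exists (N + M)%N => //= t /= ht.
have -> : t = (N + (t - N))%N by lia.
rewrite ger0_norm//.
have := aN (t - N)%N.
have : (M <= t - N)%N by lia.
move=> /gM /=; rewrite mulrC => /(le_lt_trans (ler_norm _)).
lra.
Qed.

(** The modulus is taken in [R] instead of using the [R[i]]-valued norm, so that all limits are
    limits of real sequences. *)
Definition vanishing (u : nat -> R[i]) : Prop :=
  (fun t => normc (u t)) @ \oo --> (0 : R).

Lemma normc_ge0 (z : R[i]) : 0 <= normc z.
Proof. by case: z => x y; rewrite sqrtr_ge0. Qed.

Lemma vanishingD u v :
  vanishing u -> vanishing v -> vanishing (fun t => u t + v t).
Proof.
move=> hu hv.
have huv : (fun t => normc (u t) +
   normc (v t)) @ \oo --> (0 : R).
  by have := cvgD hu hv; rewrite addr0; apply.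
apply: squeeze_cvgr (cvg_cst 0) huv.
by near=> t; rewrite normc_ge0 le_normcD.
Unshelve. all: by end_near. Qed.

Lemma vanishingM z u : vanishing u -> vanishing (fun t => z * u t).
Proof.
move=> hu.
rewrite /vanishing; under eq_fun do rewrite ComplexField.Normc.normcM.
by have := cvgM (cvg_cst (normc z)) hu; rewrite mulr0; apply.
Qed.

Lemma vanishing_sum (I : Type) (s : seq I) (u : I -> nat -> R[i]) :
  (forall i, vanishing (u i)) -> vanishing (fun t => \sum_(i <- s) u i t).
Proof.
move=> hu; elim: s => [|i s IH].
  rewrite /vanishing; under eq_fun do rewrite big_nil ComplexField.Normc.normc0.
  exact: cvg_cst.
have -> : (fun t => \sum_(j <- i :: s) u j t) =
          (fun t => u i t + \sum_(j <- s) u j t).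
  by apply/funext => t; rewrite big_cons.
exact: vanishingD.
Qed.

Lemma vanishing_real (u : nat -> R) :
  vanishing (fun t => (u t)%:C) <-> u @ \oo --> 0.
Proof.
apply: iff_trans (norm_cvg0P u); rewrite /vanishing.
suff -> : (fun t => normc (u t)%:C) = (fun t => `|u t|) by [].
by apply/funext => t; rewrite /= expr0n addr0 sqrtr_sqr.
Qed.

Lemma normc_lt1 (z : R[i]) : (`|z| < 1) = (normc z < 1).
Proof. by rewrite -[in LHS]/((normc z)%:C) -ltcR. Qed.

(** By the triangle inequality the moduli satisfy the contraction inequality with rate [normc z] and
    perturbation [normc (v t)]. *)
Lemma vanishing_recurrence z u v :
    `|z| < 1 -> (forall t, u t.+1 = z * u t + v t) ->
  vanishing v -> vanishing u.
Proof.
rewrite normc_lt1 => z1 uS; apply: (@cvg0_contraction (normc z)) => [|t|t].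
- by rewrite normc_ge0.
- exact: normc_ge0.
- by rewrite uS -ComplexField.Normc.normcM; apply: le_normcD.
Qed.

Lemma cvg_mx0P (m n : nat) (X : nat -> 'M[R]_(m, n)) :
  X @ \oo --> (0 : 'M_(m, n)) <-> forall i j, (fun t => X t i j) @ \oo --> 0.
Proof.
split=> [X0 i j|X0].
  have := continuous_cvg _ (@coord_continuous R m n i j 0) X0.
  by rewrite mxE; apply.
apply/cvg_ballP => e e0.
have : \forall t \near \oo, forall i j, ball (0 : R) e (X t i j).
  apply: filter_forall => i; apply: filter_forall => j.
  by have /cvg_ballP/(_ e e0) := X0 i j.
by apply: filterS => t Xt; split=> // i j; rewrite mxE.
Qed.
End Vanishing.

(** * Schur stability as decay of all trajectories of x[t+1] = A x[t] *)

Section Schur.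
Variable R : realType.
Local Open Scope complex_scope.
Local Notation normc := ComplexField.Normc.normc.

Definition stable_poly (b : {poly R}) : Prop :=
  forall z : R[i], root (map_poly (real_complex R) b) z -> `|z| < 1.

Lemma schur_stableE n (A : 'M[R]_n) :
  schur_stable A <-> stable_poly (char_poly A).
Proof.
by split=> sA z; have := sA z; rewrite eigenvalue_root_char -map_char_poly.
Qed.

(* One factor at a time: once (A - z) X is known to vanish, X satisfies the
   scalar recurrence X_{t+1} = z X_t + o(1) entrywise. *)
Lemma vanishing_prod n k (A : 'M[R[i]]_n.+1) (s : seq R[i])
    (X : nat -> 'M_(n.+1, k)) :
    (forall z, z \in s -> `|z| < 1) -> (forall t, X t.+1 = A *m X t) ->
    (forall i j, vanishing (fun t =>
       (horner_mx A (\prod_(z <- s) ('X - z%:P)) *m X t) i j)) ->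
  forall i j, vanishing (fun t => X t i j).
Proof.
elim: s X => [|z s IH] X hs XS hX i j.
  by have := hX i j; under eq_fun do rewrite big_nil rmorph1 mul1mx.
have hY : forall i j, vanishing (fun t => ((A - z%:M) *m X t) i j).
  apply: IH => [w ws|t|i' j'].
  - by apply: hs; rewrite inE ws orbT.
  - rewrite XS !mulmxA; congr (_ *m _).
    by rewrite mulmxBl mulmxBr scalar_mxC.
  - have := hX i' j'; congr vanishing; apply/funext => t.
    rewrite big_cons mulrC rmorphM /= rmorphB /= horner_mx_X horner_mx_C.
    by rewrite mulmxA.
apply: vanishing_recurrence (hY i j).
  by apply: (hs z); rewrite inE eqxx.
move=> t; have -> : X t.+1 = z *: X t + (A - z%:M) *m X t.
  by rewrite XS mulmxBl mul_scalar_mx addrC subrK.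
by rewrite mxE [X in X + _]mxE.
Qed.

(** Over the complex numbers the characteristic polynomial splits into factors ['X - z] with z an
    eigenvalue. By Cayley-Hamilton their product at A annihilates the trajectory, and
    [vanishing_prod] then strips the factors one by one. *)
Lemma schur_cvg0 n (A : 'M[R]_n) (x : nat -> 'cV[R]_n) :
  schur_stable A -> (forall t, x t.+1 = A *m x t) -> x @ \oo --> (0 : 'cV_n).
Proof.
case: n A x => [|n] A x sA xS; apply/cvg_mx0P => i j; first by case: i.
apply/vanishing_real.
pose Ac := map_mx (real_complex R) A.
have [s /= ps] := closed_field_poly_normal (char_poly Ac).
move: ps; rewrite (monicP (char_poly_monic _)) scale1r => ps.
suff x0 k l : vanishing (fun t => (map_mx (real_complex R) (x t)) k l).
  by have := x0 i j; congr vanishing; apply/funext => t; rewrite mxE.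
apply: (@vanishing_prod _ _ Ac s (fun t => map_mx (real_complex R) (x t)))
  => [z zs|t|i' j'].
- by apply: sA; rewrite eigenvalue_root_char ps root_prod_XsubC.
- by rewrite xS map_mxM.
- rewrite -ps Cayley_Hamilton.
  rewrite /vanishing; under eq_fun do rewrite mul0mx mxE
      ComplexField.Normc.normc0.
  exact: cvg_cst.
Qed.

(** Test on one real trajectory: for a left eigenvector v with nonzero entry [v 0 j], starting at
    the j-th basis vector gives v x[t] = z^t [v 0 j], which must vanish. *)
Lemma cvg0_schur n (A : 'M[R]_n) :
    (forall x : nat -> 'cV[R]_n, (forall t, x t.+1 = A *m x t) ->
       x @ \oo --> (0 : 'cV_n)) ->
  schur_stable A.
Proof.
move=> hA z /eigenvalueP[v vA /rV0Pn[j vj]].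
pose x t : 'cV[R]_n := iter t (mulmx A) (delta_mx j 0).
have := hA x (fun t => erefl) => /cvg_mx0P x0.
pose xc t : 'cV_n := map_mx (real_complex R) (x t).
have vx t : (v *m xc t) 0 0 = z ^+ t * v 0 j.
  rewrite /xc; elim: t => [|t IH].
    rewrite expr0 mul1r mxE (bigD1 j)//= big1 ?addr0.
      by rewrite !mxE !eqxx mulr1.
    by move=> k kj; rewrite !mxE (negPf kj) mulr0.
  by rewrite /x iterS map_mxM mulmxA vA -scalemxAl mxE IH exprS mulrA.
have : vanishing (fun t => z ^+ t * v 0 j).
  under eq_fun do rewrite -vx mxE; apply: vanishing_sum => k.
  apply: vanishingM; under eq_fun do rewrite mxE.
  exact/vanishing_real.
rewrite normc_lt1 ltNge => hv; apply/negP => z1.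
have cj : 0 < normc (v 0 j).
  rewrite lt_neqAle normc_ge0 andbT eq_sym.
  by apply: contra vj => /eqP/ComplexField.Normc.eq0_normc ->.
(* With [normc (v 0 j)] as tolerance, some N has |z^N v_j| < |v_j|, which is impossible if 1 <=
   |z|. *)
move: hv => /cvgr0Pnorm_lt/(_ _ cj)[N _ /(_ N (leqnn N))] /=.
rewrite ger0_norm ?normc_ge0// ComplexField.Normc.normcM.
apply/negP; rewrite -leNgt ler_peMl ?normc_ge0//.
elim: N => [|N IH]; first by rewrite expr0 ComplexField.Normc.normc1.
by rewrite exprS ComplexField.Normc.normcM mulr_ege1.
Qed.
End Schur.

Section CvgCol.
Variable R : realType.

Lemma cvg_col_mx0 m n k (X : nat -> 'M[R]_(m, k)) (Y : nat -> 'M[R]_(n, k)) :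
  (fun t => col_mx (X t) (Y t)) @ \oo --> (0 : 'M_(m + n, k)) <->
  X @ \oo --> (0 : 'M_(m, k)) /\ Y @ \oo --> (0 : 'M_(n, k)).
Proof.
split=> [/cvg_mx0P XY0|[/cvg_mx0P X0 /cvg_mx0P Y0]].
  split; apply/cvg_mx0P => i j.
    by have := XY0 (lshift n i) j; under eq_fun do rewrite col_mxEu.
  by have := XY0 (rshift m i) j; under eq_fun do rewrite col_mxEd.
apply/cvg_mx0P => i j; case: (split_ordP i) => k' ->.
  under eq_fun do rewrite col_mxEu.
  exact: X0.
under eq_fun do rewrite col_mxEd.
exact: Y0.
Qed.
End CvgCol.


(** * Stable proper rational functions *)

Section StableProper.
Variable R : realType.
Implicit Types (a b : {poly R}) (q : ratfun R).

Lemma stable_polyM a b :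
  stable_poly a -> stable_poly b -> stable_poly (a * b).
Proof.
by move=> sa sb z; rewrite rmorphM /= rootM => /orP[]; [apply: sa|apply: sb].
Qed.

Lemma stable_poly_dvdp a b : a %| b -> stable_poly b -> stable_poly a.
Proof.
move=> /dvdpP[c ->] sb z za; apply: sb.
by rewrite rmorphM /= rootM za orbT.
Qed.

Lemma stable_polyC (c : R) : c != 0 -> stable_poly c%:P.
Proof. by move=> c0 z; rewrite map_polyC rootC fmorph_eq0 (negPf c0). Qed.

(** A single fraction witnesses properness and stability, and it need not be reduced; sums and
    products can thus be formed without cancelling common factors. *)
Definition stable_proper q : Prop :=
  exists a b, [/\ b != 0, q = tofrac a / tofrac b, (size a <= size b)%N &
                  stable_poly b].

(** Dividing a proper fraction by its gcd keeps the degree inequality and turns the roots of the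
    denominator into poles. Conversely, by Gauss, a denominator in lowest terms divides any other
    denominator, so poles are among the roots of the stable one. *)
Lemma RHinfP m n (M : 'M[ratfun R]_(m, n)) :
  RHinf M <-> forall i j, stable_proper (M i j).
Proof.
split=> hM i j.
  have [[a [b [b0 Mab sab]]] hp] := hM i j.
  pose g := gcdp a b.
  have g0 : g != 0 by rewrite gcdp_eq0 negb_and b0 orbT.
  have [ag bg] : g %| a /\ g %| b by rewrite dvdp_gcdl dvdp_gcdr.
  have b1 : b %/ g != 0.
    by apply: contra b0 => /eqP bg0; rewrite -(divpK bg) bg0 mul0r.
  have Mab1 : M i j = tofrac (a %/ g) / tofrac (b %/ g).
    rewrite Mab -{1}(divpK ag) -{1}(divpK bg) !tofracM -mulf_div divff ?mulr1//.
    by rewrite tofrac_eq0.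
  exists (a %/ g), (b %/ g); split=> //.
    by rewrite !size_divp// leq_sub2r.
  move=> z zb; apply: hp; exists (a %/ g), (b %/ g); split=> //.
  by rewrite coprimep_div_gcd// b0 orbT.
have [a [b [b0 Mab sab sb]]] := hM i j.
split=> [|z [c [d [d0 cd Mcd zd]]]]; first by exists a, b.
apply: (stable_poly_dvdp _ sb) zd.
rewrite -(@Gauss_dvdpr _ _ c) 1?coprimep_sym//.
suff -> : c * b = a * d by apply: dvdp_mulIr.
apply/eqP; rewrite -tofrac_eq !tofracM.
by rewrite -eqr_div ?tofrac_eq0// -Mcd -Mab.
Qed.

Lemma stable_properD q r :
  stable_proper q -> stable_proper r -> stable_proper (q + r).
Proof.
move=> [a [b [b0 -> sab sb]]] [c [d [d0 -> scd sd]]].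
exists (a * d + c * b), (b * d); split.
- by rewrite mulf_neq0.
- by rewrite addf_div ?tofrac_eq0// -!tofracM -tofracD.
- rewrite (leq_trans (size_polyD _ _))// geq_max (@size_mul _ b d)//.
  apply/andP; split; apply: (leq_trans (size_polyMleq _ _)).
    by rewrite -!subn1 leq_sub2r// leq_add2r.
  by rewrite addnC -!subn1 leq_sub2r// leq_add2l.
- exact: stable_polyM.
Qed.

Lemma stable_properM q r :
  stable_proper q -> stable_proper r -> stable_proper (q * r).
Proof.
move=> [a [b [b0 -> sab sb]]] [c [d [d0 -> scd sd]]].
exists (a * c), (b * d); split.
- by rewrite mulf_neq0.
- by rewrite mulf_div -!tofracM.
- by rewrite (@size_mul _ b d)// (leq_trans (size_polyMleq _ _))//
    -!subn1 leq_sub2r// leq_add.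
- exact: stable_polyM.
Qed.

Lemma stable_properC (c : R) : stable_proper (tofrac c%:P).
Proof.
exists c%:P, 1; split; rewrite ?oner_eq0// ?tofrac1 ?divr1//.
- by rewrite size_poly1 size_polyC leq_b1.
- exact/stable_polyC/oner_neq0.
Qed.

Lemma RHinf_const m n (M : 'M[R]_(m, n)) : RHinf (constmx M).
Proof. by apply/RHinfP => i j; rewrite mxE; apply: stable_properC. Qed.

Lemma RHinfD m n (M N : 'M[ratfun R]_(m, n)) :
  RHinf M -> RHinf N -> RHinf (M + N).
Proof.
move=> /RHinfP hM /RHinfP hN; apply/RHinfP => i j; rewrite mxE.
exact: stable_properD.
Qed.

Lemma RHinfM m n k (M : 'M[ratfun R]_(m, n)) (N : 'M_(n, k)) :
  RHinf M -> RHinf N -> RHinf (M *m N).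
Proof.
move=> /RHinfP hM /RHinfP hN; apply/RHinfP => i j; rewrite mxE.
apply: big_ind => [|q r|l _]; first exact: (stable_properC 0).
  exact: stable_properD.
exact: stable_properM.
Qed.

Lemma RHinfN m n (M : 'M[ratfun R]_(m, n)) : RHinf M -> RHinf (- M).
Proof.
move=> /RHinfP hM; apply/RHinfP => i j; rewrite mxE -mulN1r -tofrac1 -tofracN.
by rewrite -polyCN; apply: stable_properM => //; apply: stable_properC.
Qed.

Lemma RHinfB m n (M N : 'M[ratfun R]_(m, n)) :
  RHinf M -> RHinf N -> RHinf (M - N).
Proof. by move=> hM /RHinfN; apply: RHinfD. Qed.

Lemma constmxD m n (M N : 'M[R]_(m, n)) :
  constmx (M + N) = constmx M + constmx N.
Proof. by apply/matrixP => i j; rewrite !mxE /= polyCD tofracD. Qed.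

Lemma constmxN m n (M : 'M[R]_(m, n)) : constmx (- M) = - constmx M.
Proof. by apply/matrixP => i j; rewrite !mxE /= polyCN tofracN. Qed.

Lemma constmxM m n k (M : 'M[R]_(m, n)) (N : 'M[R]_(n, k)) :
  constmx (M *m N) = constmx M *m constmx N.
Proof. exact: (map_mxM (@tofrac {poly R} \o polyC)). Qed.

Lemma constmx0 m n : constmx (0 : 'M[R]_(m, n)) = 0.
Proof. by apply/matrixP => i j; rewrite !mxE /= tofrac0. Qed.

Lemma constmx1 n : constmx (1%:M : 'M[R]_n) = 1%:M.
Proof. exact: (map_mx1 (@tofrac {poly R} \o polyC)). Qed.

Lemma constmx_block m1 m2 n1 n2 (M : 'M[R]_(m1, n1)) (N : 'M[R]_(m1, n2))
    (P : 'M[R]_(m2, n1)) (Q : 'M[R]_(m2, n2)) :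
  constmx (block_mx M N P Q) =
  block_mx (constmx M) (constmx N) (constmx P) (constmx Q).
Proof. exact: map_block_mx. Qed.

Lemma constmx_row m n1 n2 (M : 'M[R]_(m, n1)) (N : 'M[R]_(m, n2)) :
  constmx (row_mx M N) = row_mx (constmx M) (constmx N).
Proof. exact: map_row_mx. Qed.

Lemma constmx_col m1 m2 n (M : 'M[R]_(m1, n)) (N : 'M[R]_(m2, n)) :
  constmx (col_mx M N) = col_mx (constmx M) (constmx N).
Proof. exact: map_col_mx. Qed.

(* Locked, so that rewriting with distributivity does not split it. *)
Definition zsub n (A : 'M[R]_n) : 'M[ratfun R]_n :=
  locked ((zvar R)%:M - constmx A).

Lemma zsubE n (A : 'M[R]_n) : zsub A = (zvar R)%:M - constmx A.
Proof. by rewrite /zsub -lock. Qed.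

Lemma zsub_char_poly_mx n (A : 'M[R]_n) :
  zsub A = map_mx (@tofrac {poly R}) (char_poly_mx A).
Proof.
by rewrite zsubE; apply/matrixP => i j; rewrite !mxE tofracB tofracMn.
Qed.

Lemma resolventE n (A : 'M[R]_n) : resolvent A = invmx (zsub A).
Proof. by rewrite zsubE. Qed.

Lemma det_zsub n (A : 'M[R]_n) : \det (zsub A) = tofrac (char_poly A).
Proof. by rewrite zsub_char_poly_mx det_map_mx. Qed.

Lemma zsub_unit n (A : 'M[R]_n) : zsub A \in unitmx.
Proof.
by rewrite unitmxE det_zsub unitfE tofrac_eq0 monic_neq0 ?char_poly_monic.
Qed.

Lemma size_det_linear n (M : 'M[{poly R}]_n) :
  (forall i j, (size (M i j) <= 2)%N) -> (size (\det M) <= n.+1)%N.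
Proof.
move=> hM; apply: (leq_trans (size_sum _ _ _)); apply/bigmax_leqP => s _.
rewrite size_Msign.
apply: (leq_trans (size_poly_prod_leq _ _)).
have : (\sum_(i < n) size (M i (s i)) <= \sum_(i < n) 2)%N.
  by apply: leq_sum => i _; apply: hM.
rewrite sum_nat_const !card_ord => h.
by rewrite leq_subLR addnS ltnS (leq_trans h)// muln2 addnn.
Qed.

(** Cramer's rule: each entry is a cofactor of zI - A over the characteristic polynomial. The
    cofactor is a determinant of order n - 1 with entries of degree at most 1, hence of degree below
    n. *)
Lemma RHinf_resolvent n (A : 'M[R]_n) : schur_stable A -> RHinf (resolvent A).
Proof.
move=> /schur_stableE sA; apply/RHinfP => i j.
exists ((\adj (char_poly_mx A)) i j), (char_poly A); split=> //.
- by rewrite monic_neq0 ?char_poly_monic.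
- rewrite resolventE /invmx zsub_unit !mxE det_zsub mulrC.
  by rewrite zsub_char_poly_mx -cofactor_map_mx.
- rewrite mxE size_char_poly /cofactor.
  rewrite size_Msign.
  case: n A sA i j => [|n] A sA i j; first by case: i.
  rewrite (leq_trans (size_det_linear _))// => k l.
  rewrite !mxE (leq_trans (size_polyD _ _))// geq_max size_polyN size_polyC.
  by rewrite !(leq_trans (leq_b1 _))// andbT; case: eqP;
      rewrite ?mulr1n ?mulr0n ?size_polyX ?size_poly0.
Qed.
End StableProper.

(** * State-space realizations *)

Section Realization.
Variable R : realType.

Lemma char_poly_ublock m n (A : 'M[R]_m) B (D : 'M[R]_n) :
  char_poly (block_mx A B 0 D) = char_poly A * char_poly D.
Proof.
rewrite /char_poly /char_poly_mx map_block_mx scalar_mx_block opp_block_mx.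
by rewrite add_block_mx raddf0 oppr0 addr0 det_ublock.
Qed.

Lemma char_poly_lblock m n (A : 'M[R]_m) C (D : 'M[R]_n) :
  char_poly (block_mx A 0 C D) = char_poly A * char_poly D.
Proof.
rewrite /char_poly /char_poly_mx map_block_mx scalar_mx_block opp_block_mx.
by rewrite add_block_mx raddf0 oppr0 addr0 det_lblock.
Qed.

Lemma schur_stable_ublock m n (A : 'M[R]_m) B (D : 'M[R]_n) :
  schur_stable A -> schur_stable D -> schur_stable (block_mx A B 0 D).
Proof.
rewrite !schur_stableE char_poly_ublock; exact: stable_polyM.
Qed.

Lemma schur_stable_lblock m n (A : 'M[R]_m) C (D : 'M[R]_n) :
  schur_stable A -> schur_stable D -> schur_stable (block_mx A 0 C D).
Proof.
rewrite !schur_stableE char_poly_lblock; exact: stable_polyM.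
Qed.

Lemma zsub_block m n (A : 'M[R]_m) B C (D : 'M[R]_n) :
  zsub (block_mx A B C D) =
  block_mx (zsub A) (- constmx B) (- constmx C) (zsub D).
Proof.
by rewrite !zsubE constmx_block scalar_mx_block opp_block_mx add_block_mx
    !add0r.
Qed.

Lemma zsub_inj n k (A : 'M[R]_n) (X Y : 'M_(n, k)) :
  zsub A *m X = zsub A *m Y -> X = Y.
Proof. by move=> /(congr1 (mulmx (resolvent A)));
    rewrite resolventE !mulKmx ?zsub_unit. Qed.

Lemma mulmx_zsub_resolvent n (A : 'M[R]_n) : zsub A *m resolvent A = 1%:M.
Proof. by rewrite resolventE mulmxV ?zsub_unit. Qed.

Lemma mulmx_resolvent_zsub n (A : 'M[R]_n) : resolvent A *m zsub A = 1%:M.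
Proof. by rewrite resolventE mulVmx ?zsub_unit. Qed.

Definition realizable m p (Q : 'M[ratfun R]_(m, p)) : Prop :=
  exists d (A : 'M[R]_d) (B : 'M[R]_(d, p)) (C : 'M[R]_(m, d)) (D : 'M[R]_(m,
      p)),
    schur_stable A /\
    Q = constmx C *m resolvent A *m constmx B + constmx D.

Lemma realizable_const m p (D : 'M[R]_(m, p)) : realizable (constmx D).
Proof.
exists 0%N, 0, 0, 0, D; split.
  by move=> z /eigenvalueP[v _]; rewrite (thinmx0 v) eqxx.
by rewrite constmx0 !mul0mx add0r.
Qed.

Lemma realizableM m n p k (M : 'M[R]_(m, n)) (Q : 'M_(n, p)) (N : 'M[R]_(p, k))
    :
  realizable Q -> realizable (constmx M *m Q *m constmx N).
Proof.
move=> [d [A [B [C [D [sA ->]]]]]].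
exists d, A, (B *m N), (M *m C), (M *m D *m N); split=> //.
by rewrite !constmxM mulmxDr mulmxDl !mulmxA.
Qed.

(** Parallel connection of the two realizations. *)
Lemma realizableD m p (Q S : 'M_(m, p)) :
  realizable Q -> realizable S -> realizable (Q + S).
Proof.
move=> [d1 [A1 [B1 [C1 [D1 [s1 ->]]]]]] [d2 [A2 [B2 [C2 [D2 [s2 ->]]]]]].
exists (d1 + d2)%N, (block_mx A1 0 0 A2), (col_mx B1 B2), (row_mx C1 C2), (D1 +
    D2).
split; first exact: schur_stable_ublock.
have -> : resolvent (block_mx A1 0 0 A2) =
    block_mx (resolvent A1) 0 0 (resolvent A2).
  apply: (@zsub_inj _ _ (block_mx A1 0 0 A2)); rewrite mulmx_zsub_resolvent.
  rewrite zsub_block !constmx0 mulmx_block !oppr0 !mulmx0 !mul0mx !addr0 !add0r.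
  by rewrite !mulmx_zsub_resolvent -scalar_mx_block.
rewrite constmx_row constmx_col mul_row_block !mulmx0 addr0 add0r mul_row_col.
by rewrite constmxD addrACA.
Qed.

(** On the vector of powers, every row of zI - A but the last gives z z^i - z^(i+1) = 0; the last
    row, which holds the coefficients of b, reassembles b itself. *)
Lemma companion_col (b : {poly R}) : b \is monic ->
  char_poly_mx (companionmx b) *m (\col_(i < (size b).-1) 'X^i) =
  b *: \col_(i < (size b).-1) (i == (size b).-2 :> nat)%:R.
Proof.
move=> bm; apply/matrixP => i k; rewrite mulmxBl mul_scalar_mx !mxE.
have Sb : (size b).-1.+1 = size b.
  by rewrite prednK// size_poly_gt0 monic_neq0.
have [id|id] := eqVneq (i : nat) (size b).-2.
  rewrite mulr1 -exprS.
  have -> : \sum_j (map_mx polyC (companionmx b)) i j *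
      (\col_(i0 < (size b).-1) 'X^i0) j k =
      - \sum_(j < (size b).-1) b`_j *: 'X^j.
    rewrite -sumrN; apply: eq_bigr => j _.
    by rewrite !mxE id eqxx polyCN mulNr mul_polyC.
  have bE : b = \poly_(j < (size b).-1.+1) b`_j by rewrite Sb coefK.
  rewrite opprK [RHS]bE poly_def big_ord_recr /= addrC; congr (_ + _).
  have -> : b`_(size b).-1 = 1 by apply/eqP; rewrite -lead_coefE -monicE.
  rewrite scale1r id; congr (_ ^+ _); rewrite prednK//.
  exact: leq_ltn_trans (ltn_ord i).
have id' : (i.+1 < (size b).-1)%N.
  move: id (ltn_ord i); move: (nat_of_ord i) => l.
  by case: (size b).-1 => //= d; rewrite !ltnS ltn_neqAle => ->.
rewrite mulr0 -exprS (bigD1 (Ordinal id'))//= !mxE (negPf id) eqxx mul1r.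
rewrite big1 ?addr0 ?subrr// => j ji; rewrite !mxE (negPf id).
have -> : (i.+1 == j :> nat) = false.
  by apply: contraNF ji => /eqP ij; apply/eqP/val_inj.
by rewrite mul0r.
Qed.

(* Controllable canonical form: (zI - A)^-1 e_d = (1, z, ..., z^(d-1))^T / b. *)
Lemma realizable_scalar (q : ratfun R) : stable_proper q -> realizable (q%:M :
    'M_1).
Proof.
move=> [a [b [b0 -> sab sb]]].
(* The companion matrix has the denominator as characteristic polynomial only when that denominator
   is monic. *)
pose c := (lead_coef b)^-1; pose b1 := c *: b; pose a1 := c *: a.
have c0 : c != 0 by rewrite invr_eq0 lead_coef_eq0.
have b1m : b1 \is monic.
  by rewrite monicE lead_coefZ mulVf// lead_coef_eq0.
have b10 : b1 != 0 by rewrite monic_neq0.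
have -> : tofrac a / tofrac b = tofrac a1 / tofrac b1.
  rewrite /a1 /b1 -!mul_polyC !tofracM -mulf_div divff ?mul1r//.
  by rewrite tofrac_eq0 polyC_eq0.
(* Properness makes the quotient a constant, used as feedthrough; the coefficients of the remainder
   form the output row. *)
have sab1 : (size (a1 %/ b1)%R <= 1)%N.
  by rewrite size_divp// !size_scale// leq_subLR addn1 prednK ?size_poly_gt0.
have rb : (size (a1 %% b1)%R < size b1)%N by rewrite ltn_modp.
exists (size b1).-1, (companionmx b1), (\col_i (i == (size b1).-2 :> nat)%:R),
  (\row_i (a1 %% b1)`_i), ((a1 %/ b1)`_0)%:M; split.
  apply/schur_stableE; rewrite companionmxK//.
  by move=> z zb; apply: sb; move: zb; rewrite /b1 map_polyZ rootZ// fmorph_eq0.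
pose X := map_mx (@tofrac {poly R}) (\col_(i < (size b1).-1) 'X^i).
rewrite -mulmxA.
have -> : resolvent (companionmx b1) *m
   constmx (\col_i (i == (size b1).-2 :> nat)%:R) = (tofrac b1)^-1 *: X.
  apply: (@zsub_inj _ _ (companionmx b1));
      rewrite mulmxA mulmx_zsub_resolvent mul1mx -scalemxAr zsub_char_poly_mx.
  rewrite /X -map_mxM companion_col//; apply/matrixP => i j.
  rewrite !mxE. rewrite rmorphM mulKf ?tofrac_eq0//=.
  by case: eqP; rewrite ?tofrac1 ?tofrac0.
have CX : constmx (\row_i (a1 %% b1)`_i) *m X = (tofrac (a1 %% b1))%:M.
  apply/matrixP => i j; rewrite !ord1 !mxE eqxx mulr1n.
  have rE : a1 %% b1 = \sum_(k < (size b1).-1) (a1 %% b1)`_k *: 'X^k.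
    rewrite -(poly_def _ (fun k => (a1 %% b1)`_k)).
    apply/polyP => k; rewrite coef_poly; case: ltnP => // hk.
    by rewrite nth_default// (leq_trans _ hk)// -ltnS prednK// size_poly_gt0.
  rewrite [in RHS]rE rmorph_sum; apply: eq_bigr => k _.
  by rewrite !mxE -mul_polyC rmorphM.
rewrite -scalemxAr CX scale_scalar_mx.
have -> : constmx ((a1 %/ b1)`_0)%:M = (tofrac (a1 %/ b1))%:M :> 'M_1.
  apply/matrixP => i j; rewrite !ord1 !mxE eqxx !mulr1n /=.
  by rewrite -size1_polyC.
rewrite -raddfD; congr (_%:M); rewrite {1}(divp_eq a1 b1) tofracD tofracM.
by rewrite mulrDl mulfK ?tofrac_eq0// addrC mulrC.
Qed.

(** Realize each entry separately, place it at position (i, j) by constant column and row factors,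
    and connect all of them in parallel. *)
Lemma RHinf_realizable m p (Q : 'M[ratfun R]_(m, p)) : RHinf Q -> realizable Q.
Proof.
move=> /RHinfP hQ.
rewrite (matrix_sum_delta Q); apply: big_ind => [||i _].
- by rewrite -constmx0; apply: realizable_const.
- exact: realizableD.
apply: big_ind => [||j _].
- by rewrite -constmx0; apply: realizable_const.
- exact: realizableD.
have -> : Q i j *: delta_mx i j =
   constmx (delta_mx i 0 : 'M_(m, 1)) *m (Q i j)%:M *m constmx (delta_mx 0 j :
       'M_(1, p)).
  rewrite mul_mx_scalar -scalemxAl -constmxM mul_delta_mx.
  by apply/matrixP => k l; rewrite !mxE /=; case: andP;
      rewrite ?tofrac1 ?tofrac0.
exact/realizableM/realizable_scalar.
Qed.
End Realization.

(** * Matrix identities *)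

Lemma fmatrixP (F : fieldType) m n (M N : 'M[F]_(m, n)) :
  (forall i j, M i j = N i j) -> M = N.
Proof. by move=> MN; apply/matrixP. Qed.

Lemma addmxE (F : fieldType) m n (M N : 'M[F]_(m, n)) i j :
  (M + N) i j = M i j + N i j.
Proof. exact: mxE. Qed.

Lemma oppmxE (F : fieldType) m n (M : 'M[F]_(m, n)) i j : (- M) i j = - M i j.
Proof. exact: mxE. Qed.

Lemma mx0E (F : fieldType) m n i j : (0 : 'M[F]_(m, n)) i j = 0.
Proof. exact: mxE. Qed.

(* Abelian-group identities between matrices, proved entrywise.  Products are
   generalized as atoms up to conversion, so this is only fast when the base
   field and the matrices are abstract. *)
Ltac mx_abel :=
  apply: fmatrixP; let i := fresh "i" in intro i; let j := fresh "j" in intro j;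
  rewrite ?(addmxE, oppmxE, mx0E);
  repeat match goal with |- context [@fun_of_matrix ?T ?m ?n ?M i j] =>
    let x := fresh "x" in set x := (@fun_of_matrix T m n M i j);
    clearbody x end;
  ring.

Ltac mx_expand :=
  rewrite ?(mulmxDr, mulmxDl, mulNmx, mulmxN, mulmxA, mul1mx, mulmx1, mul0mx,
      mulmx0).

(** * Elimination of the controller state from the closed-loop resolvent *)

Section ClosedLoopAlgebra.
Variables (F : fieldType) (n m p k : nat).
Variables (zA : 'M[F]_n) (b : 'M[F]_(n, m)) (c : 'M[F]_(p, n)).
Variables (zk rk : 'M[F]_k) (bk : 'M[F]_(k, p)) (ck : 'M[F]_(m, k)).
Variables (dk : 'M[F]_(m, p)).
Variables (R11 : 'M[F]_n) (R12 : 'M[F]_(n, k)) (R21 : 'M[F]_(k, n)).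
Variables (R22 : 'M[F]_k).
Hypothesis rkK : rk *m zk = 1%:M.
Hypothesis RK : block_mx (zA - b *m dk *m c) (- (b *m ck)) (- (bk *m c)) zk
  *m block_mx R11 R12 R21 R22 = 1%:M.

Let K := ck *m rk *m bk + dk.

(** The second block row of [RK] expresses [R21] and [R22] through [R11] and [R12]. Substituting
    into the first leaves the Schur complement [zA - b *m K *m c], whose inverse is [R11]. *)
Lemma closed_loop_blocks :
  [/\ (zA - b *m K *m c) *m R11 = 1%:M, R12 = R11 *m b *m ck *m rk,
      R21 = rk *m bk *m c *m R11 & R22 = rk + rk *m bk *m c *m R12].
Proof.
move: RK; rewrite mulmx_block scalar_mx_block => /eq_block_mx[e1 e2 e3 e4].
have r21 : R21 = rk *m bk *m c *m R11.
  rewrite -[LHS]mul1mx -rkK -mulmxA.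
  have -> : zk *m R21 = bk *m c *m R11 by rewrite -[RHS]addr0 -e3; mx_expand;
      mx_abel.
  by mx_expand.
have r22 : R22 = rk + rk *m bk *m c *m R12.
  rewrite -[LHS]mul1mx -rkK -mulmxA.
  have -> : zk *m R22 = 1%:M + bk *m c *m R12 by rewrite -e4; mx_expand;
      mx_abel.
  by mx_expand.
have W11 : (zA - b *m K *m c) *m R11 = 1%:M.
  by rewrite -e1 r21 /K; mx_expand; mx_abel.
split=> //; have [Wu _] := mulmx1_unit W11.
have RW : R11 = invmx (zA - b *m K *m c) by rewrite -[LHS](mulKmx Wu) W11
    mulmx1.
rewrite RW -[LHS](mulKmx Wu) -!mulmxA; congr (_ *m _).
rewrite -[LHS]subr0 -e2 r22 /K; mx_expand; mx_abel.
Qed.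

(** The right-hand sides involve only resolvent blocks and constant matrices, not the possibly
    unstable [K]; stability of the responses is read off from them. *)
Lemma closed_loop_realization :
  [/\ R11 *m b *m K = R12 *m bk + R11 *m b *m dk,
      K *m (c *m R11 *m b *m K + 1%:M) =
        ck *m (R21 *m b *m dk + R22 *m bk)
        + dk *m (c *m (R12 *m bk + R11 *m b *m dk) + 1%:M) &
      K *m c *m R11 *m b + 1%:M =
        ck *m R21 *m b + dk *m c *m R11 *m b + 1%:M].
Proof.
have [_ -> -> ->] := closed_loop_blocks.
by split; rewrite /K; mx_expand; mx_abel.
Qed.

End ClosedLoopAlgebra.

Lemma closed_loop_constraints (F : fieldType) (n m p : nat) (zA rA Pxx :
    'M[F]_n)
    (b : 'M[F]_(n, m)) (c : 'M[F]_(p, n)) (K : 'M[F]_(m, p)) :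
    rA *m zA = 1%:M -> (zA - b *m K *m c) *m Pxx = 1%:M ->
  let Phi := block_mx (Pxx *m b *m K) (Pxx *m b)
    (K *m (c *m Pxx *m b *m K + 1%:M)) (K *m c *m Pxx *m b + 1%:M) in
  row_mx zA (- b) *m Phi = 0 /\
  Phi *m col_mx (- (c *m rA *m b)) 1%:M = col_mx (rA *m b) 1%:M.
Proof.
move=> rAK WP Phi; have PW := mulmx1C WP; have zAr := mulmx1C rAK.
have zP : zA *m Pxx = 1%:M + b *m K *m c *m Pxx.
  by rewrite -WP; mx_expand; mx_abel.
(* Resolvent identity for A and its perturbation by BKC; both affine constraints reduce to it. *)
have Pr : Pxx *m b *m K *m c *m rA = Pxx - rA.
  have -> : Pxx = Pxx *m zA *m rA by rewrite -mulmxA zAr mulmx1.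
  rewrite -[X in _ = _ - X]mul1mx -PW; mx_expand.
  by rewrite -(mulmxA Pxx zA) zAr; mx_expand; mx_abel.
have PrE k (X : 'M_(k, n)) : X *m Pxx *m b *m K *m c *m rA = X *m Pxx - X *m rA.
  by rewrite -mulmxBr -Pr; mx_expand.
split.
  rewrite mul_row_block -row_mx0; congr row_mx; mx_expand; rewrite zP;
      mx_expand; mx_abel.
rewrite mul_block_col; congr col_mx; mx_expand.
  by rewrite Pr; mx_expand; mx_abel.
by rewrite PrE; mx_expand; mx_abel.
Qed.

(* rA, rF, rL stand for the resolvents of A, A + BF, A + LC. *)
Section YoulaAlgebra.
Variables (F : fieldType) (n m p : nat).
Variables (zA rA rF rL : 'M[F]_n) (b : 'M[F]_(n, m)) (c : 'M[F]_(p, n)).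
Variables (f : 'M[F]_(m, n)) (l : 'M[F]_(n, p)).
Hypothesis rAK : rA *m zA = 1%:M.
Hypothesis rFK : rF *m (zA - b *m f) = 1%:M.
Hypothesis rLK : rL *m (zA - l *m c) = 1%:M.

(** Resolvent identity for A and A + BF. The free left factor [X] lets it rewrite inside
    left-associated products. *)
Let rFA k (X : 'M[F]_(k, n)) : X *m rA *m b *m f *m rF = X *m rF - X *m rA.
Proof.
have zF := mulmx1C rFK.
rewrite -!mulmxA -mulmxBr; congr (_ *m _).
have -> : b *m (f *m rF) = zA *m rF - 1%:M by rewrite -zF; mx_expand; mx_abel.
by rewrite mulmxBr mulmxA rAK; mx_expand.
Qed.

Let rFL k (X : 'M[F]_(k, n)) :
  X *m rF *m l *m c *m rL = X *m rL - X *m rF + X *m rF *m b *m f *m rL.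
Proof.
have zL := mulmx1C rLK.
rewrite -!mulmxA -mulmxBr -mulmxDr; congr (_ *m _).
have -> : l *m (c *m rL) = zA *m rL - 1%:M by rewrite -zL; mx_expand; mx_abel.
have : rF *m zA *m rL = rL + rF *m b *m f *m rL.
  rewrite -[X in _ = X + _]mul1mx -rFK; mx_expand; mx_abel.
by move=> e; mx_expand; rewrite e; mx_abel.
Qed.

Section Bezout.
Variables (Ut : 'M[F]_m) (Vt : 'M[F]_(m, p)).
Hypothesis bezout : Ut *m (1%:M + f *m rF *m b) - Vt *m (c *m rF *m b) = 1%:M.

(** This inverts the Youla parametrization: the two formulas are the left factors of the
    observer-based controller with parameter [Q]. Expanding with [rFL] leaves terms in
    [Ut *m f *m rF *m b], which the Bezout identity eliminates. *)
Lemma youla_parameter (Q := Vt *m (1%:M - c *m rF *m l) + Ut *m (f *m rF *m l))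
    :
  Ut = 1%:M - (f - Q *m c) *m rL *m b /\ Vt = Q - (f - Q *m c) *m rL *m l.
Proof.
have E : Ut *m f *m rF *m b = 1%:M - Ut + Vt *m c *m rF *m b.
  by rewrite -bezout; mx_expand; mx_abel.
by rewrite /Q; split; mx_expand; rewrite !rFL; mx_expand; rewrite !E;
    mx_expand; mx_abel.
Qed.
End Bezout.

Section Factorization.
Variables (Pxy : 'M[F]_(n, p)) (Pxu : 'M[F]_(n, m)).
Variables (Puy : 'M[F]_(m, p)) (Puu : 'M[F]_m).
Hypothesis eq_xy : zA *m Pxy = b *m Puy.
Hypothesis eq_xu : zA *m Pxu = b *m Puu.
Hypothesis eq_u : Puu - Puy *m (c *m rA *m b) = 1%:M.
Let Ut := Puu - f *m Pxu.
Let Vt := Puy - f *m Pxy.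

Let UtE : Ut = (1%:M - f *m rA *m b) *m Puu.
Proof.
by rewrite /Ut -[Pxu]mul1mx -rAK -(mulmxA rA) eq_xu; mx_expand.
Qed.

Let VtE : Vt = (1%:M - f *m rA *m b) *m Puy.
Proof.
by rewrite /Vt -[Pxy]mul1mx -rAK -(mulmxA rA) eq_xy; mx_expand.
Qed.

Let MK : (1%:M - f *m rA *m b) *m (1%:M + f *m rF *m b) = 1%:M.
Proof. by mx_expand; rewrite rFA; mx_expand; mx_abel. Qed.

(** Since [Pxu] = [rA *m b *m Puu] and likewise for [Pxy], passing to [Ut] and [Vt] multiplies [Puu]
    and [Puy] on the left by [1%:M - f *m rA *m b], the inverse of M. *)
Lemma response_factorization :
  [/\ 1%:M + f *m rF *m b \in unitmx,
      Puu = (1%:M + f *m rF *m b) *m Ut, Puy = (1%:M + f *m rF *m b) *m Vt &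
      Ut *m (1%:M + f *m rF *m b) - Vt *m (c *m rF *m b) = 1%:M].
Proof.
have KM := mulmx1C MK.
split; first by have [] := mulmx1_unit KM.
  by rewrite UtE mulmxA KM mul1mx.
  by rewrite VtE mulmxA KM mul1mx.
(* This is N = GM; the Bezout identity becomes [eq_u] conjugated by M. *)
have -> : c *m rF *m b = c *m rA *m b *m (1%:M + f *m rF *m b).
  by mx_expand; rewrite rFA; mx_expand; mx_abel.
transitivity ((1%:M - f *m rA *m b) *m (Puu - Puy *m (c *m rA *m b)) *m
    (1%:M + f *m rF *m b)).
  by rewrite UtE VtE; mx_expand; mx_abel.
by rewrite eq_u mulmx1 MK.
Qed.
End Factorization.
End YoulaAlgebra.

(** View the controller as a system driven by both u (through [bu]) and y (through [bw]) with output
    u. Closing the loop on u produces K, and the return difference [Ut] has inverse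
    [1%:M + ck *m rk *m bu]. *)
Lemma controller_factorization (F : fieldType) (d m p : nat) (zu ru rk :
    'M[F]_d)
    (bu : 'M[F]_(d, m)) (bw : 'M[F]_(d, p)) (ck : 'M[F]_(m, d))
    (dk : 'M[F]_(m, p)) (Ut : 'M[F]_m) (Vt K : 'M[F]_(m, p)) :
    ru *m zu = 1%:M -> rk *m (zu - bu *m ck) = 1%:M ->
    1%:M - ck *m ru *m bu = Ut -> ck *m ru *m bw + dk = Vt ->
    ck *m rk *m (bw + bu *m dk) + dk = K ->
  Ut \in unitmx /\ Ut *m K = Vt.
Proof.
move=> ruK /mulmx1C zk <- <- <-.
have E k (X : 'M_(k, d)) : X *m ru *m bu *m ck *m rk = X *m rk - X *m ru.
  rewrite -!mulmxA -mulmxBr; congr (_ *m _).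
  have -> : bu *m (ck *m rk) = zu *m rk - 1%:M by rewrite -zk; mx_expand;
      mx_abel.
  by rewrite mulmxBr mulmxA ruK; mx_expand.
split; last by mx_expand; rewrite !E; mx_expand; mx_abel.
have : (1%:M - ck *m ru *m bu) *m (1%:M + ck *m rk *m bu) = 1%:M.
  by mx_expand; rewrite E; mx_expand; mx_abel.
by case/mulmx1_unit.
Qed.

Lemma observer_controller_row (F : fieldType) (n m p d k : nat)
    (rL : 'M[F]_n) (rq : 'M[F]_d) (c : 'M[F]_(p, n)) (f : 'M[F]_(m, n))
    (bq : 'M[F]_(d, p)) (cq : 'M[F]_(m, d)) (dq : 'M[F]_(m, p))
    (x : 'M[F]_(n, k)) (y : 'M[F]_(d, k)) :
  row_mx (f - dq *m c) cq *m block_mx rL 0 (rq *m - (bq *m c) *m rL) rq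
    *m col_mx x y =
  (f - (cq *m rq *m bq + dq) *m c) *m rL *m x + cq *m rq *m y.
Proof.
by rewrite mul_row_block mul_row_col; mx_expand; mx_abel.
Qed.

(** * Closed loop and observer-based controller *)

Section Resolvent.
Variable R : realType.

Lemma zsubD n (A E : 'M[R]_n) : zsub (A + E) = zsub A - constmx E.
Proof. by rewrite !zsubE constmxD opprD addrA. Qed.

Lemma resolvent_lblock m n (A : 'M[R]_m) C (D : 'M[R]_n) :
  resolvent (block_mx A 0 C D) =
  block_mx (resolvent A) 0 (resolvent D *m constmx C *m resolvent A) (resolvent
      D).
Proof.
apply: (@zsub_inj _ _ _ (block_mx A 0 C D)).
rewrite mulmx_zsub_resolvent zsub_block constmx0 oppr0 mulmx_block.
rewrite !mulmx0 !mul0mx !addr0 !add0r !mulmxA !mulmx_zsub_resolvent mul1mx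
    mulNmx.
by rewrite addNr -scalar_mx_block.
Qed.
End Resolvent.

(** * The autonomous closed loop and the stability of its responses *)

Section ClosedLoopMatrix.
Variables (R : realType) (n m p : nat).
Variables (A : 'M[R]_n) (B : 'M[R]_(n, m)) (C : 'M[R]_(p, n)).

Definition closed_loop_mx (c : controller R p m) : 'M[R]_(n + kdim c) :=
  block_mx (A + B *m Dk c *m C) (B *m Ck c) (Bk c *m C) (Ak c).

(** Any trajectory of the autonomous system splits into x and xi; y and u are then defined by the
    output equations, giving an undisturbed closed loop. *)
Lemma internally_stabilizing_schur c :
  internally_stabilizing A B C c -> schur_stable (closed_loop_mx c).
Proof.
move=> sc; apply: cvg0_schur => s sS.
pose x t := usubmx (s t); pose xi t := dsubmx (s t).
have sE : s = (fun t => col_mx (x t) (xi t)).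
  by apply/funext => t; rewrite vsubmxK.
rewrite sE; apply/cvg_col_mx0.
apply: (sc x xi (fun t => C *m x t) (fun t => Ck c *m xi t + Dk c *m (C *m x
    t))).
move=> t; have st : s t.+1 =
    col_mx (A *m x t + B *m (Ck c *m xi t + Dk c *m (C *m x t)))
           (Ak c *m xi t + Bk c *m (C *m x t)).
  rewrite sS {1}sE mul_block_col; congr col_mx; last by rewrite addrC !mulmxA.
  by rewrite mulmxDl mulmxDr !mulmxA; mx_abel.
by split; rewrite ?addr0// ?/x ?/xi st ?col_mxKu ?col_mxKd.
Qed.

Lemma RHinf_blocks n1 n2 (M : 'M[ratfun R]_(n1 + n2)) : RHinf M ->
  [/\ RHinf (ulsubmx M), RHinf (ursubmx M), RHinf (dlsubmx M) & RHinf (drsubmx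
      M)].
Proof. by move=> hM; split=> i j; rewrite !mxE; apply: hM. Qed.


Lemma closed_loop_responses c : schur_stable (closed_loop_mx c) ->
  let K := controller_tf c in response_constraints A B C
    (Phi_xy A B C K) (Phi_xu A B C K) (Phi_uy A B C K) (Phi_uu A B C K).
Proof.
move=> /RHinf_resolvent/RHinf_blocks[]; set RR := resolvent (closed_loop_mx c).
move=> s11 s12 s21 s22 K.
have := mulmx_zsub_resolvent (closed_loop_mx c).
rewrite -/RR -[RR]submxK zsub_block zsubD !constmxM => RK.
have [W11 _ _ _] := closed_loop_blocks (mulmx_resolvent_zsub (Ak c)) RK.
have [xyE uyE uuE] := closed_loop_realization (mulmx_resolvent_zsub (Ak c)) RK.
have KE : constmx (Ck c) *m resolvent (Ak c) *m constmx (Bk c) + constmx (Dk c)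
    = K.
  by [].
rewrite KE in W11 xyE uyE uuE.
have PE : Phi_xx A B C K = ulsubmx RR.
  have [Wu _] := mulmx1_unit W11.
  by rewrite -[RHS](mulKmx Wu) W11 mulmx1 /Phi_xx -zsubE.
have [c1 c2] := closed_loop_constraints (mulmx_resolvent_zsub A) W11.
rewrite /response_constraints -zsubE /Phi_uy /Phi_uu /Phi_xy /Phi_xu PE.
split=> //; rewrite xyE uyE uuE; split;
  by do ?[apply: RHinfD|apply: RHinfM|apply: RHinf_const|rewrite -constmx1].
Qed.
End ClosedLoopMatrix.

Section ObserverController.
Variables (R : realType) (n m p d : nat).
Variables (A : 'M[R]_n) (B : 'M[R]_(n, m)) (C : 'M[R]_(p, n)).
Variables (F : 'M[R]_(m, n)) (L : 'M[R]_(n, p)).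
Variables (Aq : 'M[R]_d) (Bq : 'M[R]_(d, p)) (Cq : 'M[R]_(m, d)) (Dq :
    'M[R]_(m, p)).
Hypothesis stabF : schur_stable (A + B *m F).
Hypothesis stabL : schur_stable (A + L *m C).
Hypothesis stabq : schur_stable Aq.

(** State matrix of observer and filter when u and y are both treated as external inputs. *)
Definition observer_driven_mx : 'M[R]_(n + d) :=
  block_mx (A + L *m C) 0 (- (Bq *m C)) Aq.

(* State (xh, q): a Luenberger observer xh of the plant, and the state q of a
   stable filter Q fed with the innovation y - C xh; the output is
   u = F xh + Q (y - C xh). *)
Definition observer_controller : controller R p m :=
  let Bu := col_mx B 0 in
  let Cu := row_mx (F - Dq *m C) Cq in
  Controller (observer_driven_mx + Bu *m Cu)
    (col_mx (- L) Bq + Bu *m Dq) Cu Dq.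

(* The feedback y = C xh cancels the innovation. *)
Lemma observer_controller_stabilizable :
  stabilizable (Ak observer_controller) (Bk observer_controller).
Proof.
exists (row_mx C 0) => /=.
suff -> : observer_driven_mx + col_mx B 0 *m row_mx (F - Dq *m C) Cq
    + (col_mx (- L) Bq + col_mx B 0 *m Dq) *m row_mx C 0
  = block_mx (A + B *m F) (B *m Cq) 0 Aq by exact: schur_stable_ublock.
rewrite (mul_col_mx _ _ Dq) add_col_mx !mul_col_row !add_block_mx.
by congr block_mx; mx_expand; mx_abel.
Qed.

(* The output injection - B u removes the feedback of u into the observer. *)
Lemma observer_controller_detectable :
  detectable (Ak observer_controller) (Ck observer_controller).
Proof.
exists (- col_mx B 0) => /=; rewrite mulNmx addrK.
exact: schur_stable_lblock.
Qed.

Lemma observer_controller_internally_stabilizing :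
  internally_stabilizing A B C observer_controller.
Proof.
move=> x xi y u cl.
pose xh t := usubmx (xi t); pose q t := dsubmx (xi t).
have xiE t : xi t = col_mx (xh t) (q t) by rewrite vsubmxK.
pose e t := x t - xh t.
(* The error e evolves by A + LC alone, the innovation C e drives q, and u equals F x + (Dq C - F) e
   + Cq q. *)
have step t : col_mx (x t.+1) (col_mx (e t.+1) (q t.+1)) =
    block_mx (A + B *m F) (row_mx (B *m (Dq *m C - F)) (B *m Cq)) 0
      (block_mx (A + L *m C) 0 (Bq *m C) Aq)
    *m col_mx (x t) (col_mx (e t) (q t)).
  have [xS yE xiS uE] := cl t.
  move: xiS; rewrite xiE /= (mul_col_mx _ _ Dq) add_col_mx mul_col_row
      add_block_mx.
  rewrite yE addr0 xiE mul_block_col mul_col_mx add_col_mx.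
  move=> /eq_col_mx[xhS qS].
  rewrite /e xS xhS qS uE yE xiE /= !addr0 !mul_row_col.
  rewrite mul_block_col mul_row_col mul_block_col.
  congr col_mx; first by mx_expand; mx_abel.
  by rewrite [X in _ = X + _]mul0mx [RHS]add0r; congr col_mx; mx_expand;
      mx_abel.
have /cvg_col_mx0[x0 /cvg_col_mx0[e0 q0]] :=
  schur_cvg0 (schur_stable_ublock stabF (schur_stable_lblock stabL stabq)) step.
split=> //; have -> : xi = (fun t => col_mx (x t - e t) (q t)).
  by apply/funext => t; rewrite xiE /e opprB addrC subrK.
apply/cvg_col_mx0; split=> //.
move/cvg_mx0P: x0 => x0; move/cvg_mx0P: e0 => e0.
apply/cvg_mx0P => i j; under eq_fun do rewrite addmxE oppmxE.
by have := cvgB (x0 i j) (e0 i j); rewrite subr0; apply.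
Qed.

Lemma observer_controller_tf (Q := constmx Cq *m resolvent Aq *m constmx Bq +
    constmx Dq)
    (Ut := 1%:M - (constmx F - Q *m constmx C) *m resolvent (A + L *m C) *m
    constmx B) :
  Ut \in unitmx /\
  Ut *m controller_tf observer_controller =
  Q - (constmx F - Q *m constmx C) *m resolvent (A + L *m C) *m constmx L.
Proof.
have zkE : resolvent (Ak observer_controller) *m
    (zsub observer_driven_mx - constmx (col_mx B 0) *m constmx (row_mx (F - Dq
    *m C) Cq))
    = 1%:M.
  by rewrite -constmxM -zsubD mulmx_resolvent_zsub.
have rowE k (X : 'M_(n, k)) (Y : 'M_(d, k)) :
    constmx (row_mx (F - Dq *m C) Cq) *m resolvent observer_driven_mx *m col_mx
    X Y
    = (constmx F - Q *m constmx C) *m resolvent (A + L *m C) *m X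
      + constmx Cq *m resolvent Aq *m Y.
  rewrite -observer_controller_row resolvent_lblock constmx_row.
  by rewrite constmxD !constmxN !constmxM.
apply: (controller_factorization (bw := constmx (col_mx (- L) Bq))
  (dk := constmx Dq) (mulmx_resolvent_zsub observer_driven_mx) zkE).
- by rewrite constmx_col rowE constmx0 mulmx0 addr0.
- by rewrite constmx_col rowE constmxN mulmxN -addrA addrC.
- by rewrite /controller_tf /= constmxD constmxM.
Qed.
End ObserverController.

(** * From admissible responses to a stabilizing controller *)

Lemma responses_youla_controller (R : realType) (n m p : nat)
    (A : 'M[R]_n) (B : 'M[R]_(n, m)) (C : 'M[R]_(p, n)) Pxy Pxu Puy Puu :
    stabilizable A B -> detectable A C ->
    response_constraints A B C Pxy Pxu Puy Puu ->
  Puu \in unitmx /\ Cstab A B C (invmx Puu *m Puy).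
Proof.
move=> [F sF] [L sL] [e1 e2 [sxy suy sxu suu]].
move: e1; rewrite -zsubE mul_row_block -row_mx0 => /eq_row_mx[].
rewrite !mulNmx => /eqP; rewrite subr_eq0 => /eqP exy /eqP.
rewrite subr_eq0 => /eqP exu.
move: e2; rewrite mul_block_col => /eq_col_mx[_].
rewrite mulmxN mulmx1 addrC => eu.
have rA := mulmx_resolvent_zsub A.
have rF := mulmx_resolvent_zsub (A + B *m F); rewrite zsubD constmxM in rF.
have rL := mulmx_resolvent_zsub (A + L *m C); rewrite zsubD constmxM in rL.
have [Mu PuuE PuyE bez] := response_factorization rA rF exy exu eu.
have [] := youla_parameter rF rL bez.
set Ut := Puu - _; set Vt := Puy - _; set Q := Vt *m _ + _.
move=> UtE VtE.
have sQ : RHinf Q.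
  have sFr := RHinf_resolvent sF.
  by rewrite /Q /Ut /Vt -constmx1;
    do ?[apply: RHinfD|apply: RHinfB|apply: RHinfN|apply: RHinfM|apply:
    RHinf_const].
have [d [Aq [Bq [Cq [Dq [sq QE]]]]]] := RHinf_realizable sQ.
pose c := observer_controller A B C F L Aq Bq Cq Dq.
have [] := observer_controller_tf A B C F L Aq Bq Cq Dq.
rewrite -QE -UtE -VtE => Utu cE.
have Puu_unit : Puu \in unitmx.
  by rewrite PuuE unitmx_mul Mu.
split=> //; exists c; split.
(* The common left factor M relates the two quotients: [Puu] K = M [Ut] K = M [Vt] = [Puy]. *)
- by rewrite -[LHS](mulKmx Puu_unit) {2}PuuE -(mulmxA _ Ut) cE -PuyE.
- exact: observer_controller_stabilizable.
- exact: observer_controller_detectable.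
- exact: observer_controller_internally_stabilizing.
Qed.

Theorem proposition4 (R : realType) (n m p : nat)
    (A : 'M[R]_n) (B : 'M[R]_(n, m)) (C : 'M[R]_(p, n))
    (stabAB : stabilizable A B) (detAC : detectable A C) :
  (forall K : 'M[ratfun R]_(m, p), Cstab A B C K ->
     response_constraints A B C
       (Phi_xy A B C K) (Phi_xu A B C K) (Phi_uy A B C K) (Phi_uu A B C K)) /\
  (forall (Pxy : 'M[ratfun R]_(n, p)) (Pxu : 'M[ratfun R]_(n, m))
      (Puy : 'M[ratfun R]_(m, p)) (Puu : 'M[ratfun R]_m),
     response_constraints A B C Pxy Pxu Puy Puu ->
     Puu \in unitmx /\ Cstab A B C (invmx Puu *m Puy)).
Proof.
split=> [K [c [<- _ _ sc]]|Pxy Pxu Puy Puu].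
  exact/closed_loop_responses/internally_stabilizing_schur.
exact: responses_youla_controller.
Qed.
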